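(* Let $s=s_1+s_2$ with $s_1,s_2\in\mathbb{N}_0$ not both equal to $0$. Let $\mathbf{b}=(b_1,\ldots,b_s)$ be a vector of $s$ not necessarily distinct integers $b_i\ge 2$, let $\mathbf{b}^{(1)}=(b_1,\ldots,b_{s_1})$, $\mathbf{b}^{(2)}=(b_{s_1+1},\ldots,b_s)$, and consider the hybrid function system $\mathcal{W}_{\mathbf{b}^{(1)}}\otimes\Gamma_{\mathbf{b}^{(2)}}=\{\xi_{\mathbf{k}}:\mathbf{k}\in\mathbb{N}_0^s\}$ on $[0,1)^s$ (Walsh functions in base $\mathbf{b}^{(1)}$ in the first $s_1$ coordinates, $\mathbf{b}^{(2)}$-adic functions in the last $s_2$ coordinates). Let $N\in\mathbb{N}$ and let $\omega=(\mathbf{x}_n)_{n\ge 0}$ be a (possibly finite) sequence in $[0,1)^s$ with at least $N$ elements. Then, for all $\mathbf{g}=(g_1,\ldots,g_s)\in\mathbb{N}^s$, $$D_N(\omega)\;\le\;\epsilon_{\mathbf{b}}(\mathbf{g})+\sum_{\mathbf{k}\in\Delta_{\mathbf{b}}^*(\mathbf{g})}\rho_{\mathbf{b}}(\mathbf{k})\,\left|S_N(\xi_{\mathbf{k}},\omega)\right|$$ and $$D_N^*(\omega)\;\le\;\epsilon^*_{\mathbf{b}}(\mathbf{g})+\sum_{\mathbf{k}\in\Delta_{\mathbf{b}}^*(\mathbf{g})}\rho^*_{\mathbf{b}}(\mathbf{k})\,\left|S_N(\xi_{\mathbf{k}},\omega)\right|,$$ where $$\epsilon_{\mathbf{b}}(\mathbf{g})=1-\prod_{i=1}^s\left(1-2b_i^{-g_i}\right),\qquad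 \epsilon^*_{\mathbf{b}}(\mathbf{g})=1-\prod_{i=1}^s\left(1-b_i^{-g_i}\right).$$
   Context: Notation: $\mathbb{N}=\{1,2,\ldots\}$, $\mathbb{N}_0=\mathbb{N}\cup\{0\}$, $e(y)=\mathrm{e}^{2\pi\mathrm{i}y}$ for real $y$, $\lambda_s$ is Lebesgue measure on $[0,1)^s$; empty products equal $1$. Digits: for an integer $b\ge2$ and $k\in\mathbb{N}_0$ write $k=\sum_{j\ge0}k_jb^j$ with $k_j\in\{0,\ldots,b-1\}$. Every $x\in[0,1)$ has a unique regular $b$-adic representation $x=\sum_{j\ge0}x_jb^{-j-1}$, $x_j\in\{0,\ldots,b-1\}$, with $x_j\ne b-1$ for infinitely many $j$. Put $\varphi_b(k)=\sum_{j\ge0}k_jb^{-j-1}\in[0,1)$ (radical inverse). Walsh functions: $w_k(x)=e\big(\tfrac1b\sum_{j\ge0}k_jx_j\big)$, with $x_j$ the regular digits of $x$. $b$-adic functions: $\gamma_k(x)=e\big(\varphi_b(k)(x_0+x_1b+x_2b^2+\cdots)\big)$, with $x_j$ the regular digits of $x$; if $k<b^g$ then $\varphi_b(k)b^j\in\mathbb{Z}$ for all $j\ge g$, so only the finitely many digits $x_0,\ldots,x_{g-1}$ matter and the value is defined as $e\big(\varphi_b(k)(x_0+\cdots+x_{g-1}b^{g-1})\big)$. Hybrid system: for $\mathbf{k}=(k_1,\ldots,k_s)\in\mathbb{N}_0^s$ and $\mathbf{x}=(x_1,\ldots,x_s)\in[0,1)^s$, $\xi_{\mathbf{k}}(\mathbf{x})=\prod_{i=1}^{s_1}w_{k_i}(x_i)\prod_{i=s_1+1}^{s}\gamma_{k_i}(x_i)$,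 where the $i$th factor is taken with respect to base $b_i$. Domains: $\Delta_{\mathbf{b}}(\mathbf{g})=\{\mathbf{k}\in\mathbb{N}_0^s:0\le k_i<b_i^{g_i},\,1\le i\le s\}$ and $\Delta^*_{\mathbf{b}}(\mathbf{g})=\Delta_{\mathbf{b}}(\mathbf{g})\setminus\{\mathbf{0}\}$. Weights: $\rho_b(0)=1$ and $\rho_b(k)=\dfrac{2}{b^t\sin(\pi k_{t-1}/b)}$ if $b^{t-1}\le k<b^t$, $t\in\mathbb{N}$ (so $k_{t-1}\neq0$ is the leading digit of $k$); $\rho_b^*(0)=1$ and $\rho_b^*(k)=\rho_b(k)/2$ for $k\ge1$; $\rho_{\mathbf{b}}(\mathbf{k})=\prod_{i=1}^s\rho_{b_i}(k_i)$, $\rho^*_{\mathbf{b}}(\mathbf{k})=\prod_{i=1}^s\rho^*_{b_i}(k_i)$. Averages and discrepancy: $S_N(f,\omega)=\frac1N\sum_{n=0}^{N-1}f(\mathbf{x}_n)$ for $f:[0,1)^s\to\mathbb{C}$. $D_N(\omega)=\sup_J|S_N(\mathbf{1}_J-\lambda_s(J),\omega)|$, the supremum over all $J=\prod_{i=1}^s[u_i,v_i)$ with $0\le u_i<v_i\le1$; $D_N^*(\omega)$ is the same supremum restricted to intervals $J=\prod_{i=1}^s[0,v_i)$ with $0<v_i\le1$. *)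

(* Defs.v *)
From HB Require Import structures.
From mathcomp Require Import all_boot all_order all_algebra.
From mathcomp Require Import complex.
From mathcomp Require Import all_classical all_reals all_analysis.
From mathcomp Require Import measurable_realfun.
From mathcomp Require Import ring lra.

Set Implicit Arguments.
Unset Strict Implicit.
Unset Printing Implicit Defensive.

Import Order.TTheory GRing.Theory Num.Theory.
Import numFieldNormedType.Exports.

Local Open Scope classical_set_scope.
Local Open Scope ring_scope.

Definition nat_digit (b k j : nat) : nat := ((k %/ b ^ j) %% b)%N.

(* The least t with k < b ^ t, so that b ^ (t - 1) <= k < b ^ t when 0 < k.
   Sums over all j >= 0 involving the digits of k are truncated there, which
   is harmless by [nat_digit_eq0]. *)
Definition ndigits (b k : nat) : nat :=
  if k == 0%N then 0%N else (trunc_log b k).+1.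

Definition radical_inverse (R : realType) (b k : nat) : R :=
  \sum_(j < ndigits b k) (nat_digit b k j)%:R / b%:R ^+ j.+1.

Definition regular_repr (R : realType) (b : nat) (x : R) (d : nat -> nat) :=
  [/\ (forall j, (d j < b)%N),
      [series (d j)%:R / b%:R ^+ j.+1]_j @ \oo --> x &
      forall m, exists2 j, (m <= j)%N & d j != b.-1].

(* [regular_repr] determines these digits on [0, 1): see [real_digitP] and
   [regular_repr_uniq]. The value is junk elsewhere. *)
Definition real_digit (R : realType) (b : nat) (x : R) : nat -> nat :=
  xget (fun=> 0%N) [set d | regular_repr b x d].

Definition expi2pi (R : realType) (y : R) : R[i] :=
  (cos (2 * pi * y) +i* sin (2 * pi * y))%C.

Definition walsh (R : realType) (b k : nat) (x : R) : R[i] :=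
  expi2pi (b%:R^-1 *
     (\sum_(j < ndigits b k) nat_digit b k j * real_digit b x j)%N%:R).

(* The digits x_j with j >= ndigits b k only add integers to the argument. *)
Definition badic (R : realType) (b k : nat) (x : R) : R[i] :=
  expi2pi (radical_inverse R b k *
     (\sum_(j < ndigits b k) real_digit b x j * b ^ j)%N%:R).

Definition xi (R : realType) (s1 s2 : nat) (b : 'I_(s1 + s2) -> nat)
    (k : {ffun 'I_(s1 + s2) -> nat}) (x : (s1 + s2).-tuple R) : R[i] :=
  (\prod_(i < s1)
     walsh (b (lshift s2 i)) (k (lshift s2 i)) (tnth x (lshift s2 i))) *
  (\prod_(i < s2)
     badic (b (rshift s1 i)) (k (rshift s1 i)) (tnth x (rshift s1 i))).

Definition Delta (s : nat) (b g : 'I_s -> nat) : set {ffun 'I_s -> nat} :=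
  [set k | forall i, (k i < b i ^ g i)%N].

Definition Delta_star (s : nat) (b g : 'I_s -> nat) :
    set {ffun 'I_s -> nat} :=
  Delta b g `\ [ffun=> 0%N].

Definition rho1 (R : realType) (b k : nat) : R :=
  if k == 0%N then 1
  else let t := ndigits b k in
       2 / (b%:R ^+ t * sin (pi * (nat_digit b k t.-1)%:R / b%:R)).

Definition rho1_star (R : realType) (b k : nat) : R :=
  if k == 0%N then 1 else rho1 R b k / 2.

Definition rho (R : realType) (s : nat) (b : 'I_s -> nat)
    (k : {ffun 'I_s -> nat}) : R :=
  \prod_(i < s) rho1 R (b i) (k i).

Definition rho_star (R : realType) (s : nat) (b : 'I_s -> nat)
    (k : {ffun 'I_s -> nat}) : R :=
  \prod_(i < s) rho1_star R (b i) (k i).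

(* [K] is R[i] for the functions [xi] and R for centred indicators. *)
Definition S_avg (K : fieldType) (T : Type) (N : nat) (f : T -> K)
    (omega : nat -> T) : K :=
  N%:R^-1 * \sum_(n < N) f (omega n).

(* Lebesgue measure on R^n, as the iterated product measure transported along
   (t, y) |-> t :: y. *)
Fixpoint lebesgue_tuple (R : realType) (n : nat) :
    set (n.-tuple R) -> \bar R :=
  match n return set (n.-tuple R) -> \bar R with
  | 0 => dirac [tuple]
  | m.+1 => pushforward
      (product_measure1 (T1 := measurableTypeR R)
         (T2 := m.-tuple (measurableTypeR R))
         (@lebesgue_measure R) (@lebesgue_tuple R m))
      (fun p : R * m.-tuple R => [tuple of p.1 :: p.2])
  end.

Definition box (R : realType) (s : nat) (u v : 'I_s -> R) :
    set (s.-tuple R) :=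
  [set x | forall i, u i <= tnth x i < v i].

Definition boxes (R : realType) (s : nat) : set (set (s.-tuple R)) :=
  [set J | exists u v : 'I_s -> R,
     (forall i, [/\ 0 <= u i, u i < v i & v i <= 1]) /\ J = box u v].

Definition anchored_boxes (R : realType) (s : nat) :
    set (set (s.-tuple R)) :=
  [set J | exists v : 'I_s -> R,
     (forall i, 0 < v i <= 1) /\ J = box (fun=> 0) v].

Definition discrepancy_over (R : realType) (s : nat)
    (C : set (set (s.-tuple R))) (N : nat) (omega : nat -> s.-tuple R) : R :=
  sup [set `|S_avg N (fun x => \1_J x - fine (lebesgue_tuple J)) omega|
      | J in C].

Definition discrepancy (R : realType) (s N : nat)
    (omega : nat -> s.-tuple R) : R :=
  discrepancy_over (@boxes R s) N omega.

Definition star_discrepancy (R : realType) (s N : nat)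
    (omega : nat -> s.-tuple R) : R :=
  discrepancy_over (@anchored_boxes R s) N omega.

Definition epsilon (R : realType) (s : nat) (b g : 'I_s -> nat) : R :=
  1 - \prod_(i < s) (1 - 2 * (b i)%:R ^- g i).

Definition epsilon_star (R : realType) (s : nat) (b g : 'I_s -> nat) : R :=
  1 - \prod_(i < s) (1 - (b i)%:R ^- g i).

Lemma nat_digit_eq0 (b k j : nat) :
  (2 <= b)%N -> (ndigits b k <= j)%N -> nat_digit b k j = 0%N.
Proof.
rewrite /ndigits /nat_digit => b2; case: eqP => [-> _|/eqP k0 tj].
  by rewrite div0n mod0n.
rewrite divn_small ?mod0n//; apply: (leq_trans (trunc_log_ltn k b2)).
by rewrite leq_exp2l.
Qed.

Lemma Delta_finite (s : nat) (b g : 'I_s -> nat) : finite_set (Delta b g).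
Proof.
pose M := (\max_(i < s) b i ^ g i)%N.
pose h (f : {ffun 'I_s -> 'I_M.+1}) : {ffun 'I_s -> nat} :=
  [ffun i => nat_of_ord (f i)].
apply: (@sub_finite_set _ _ (h @` setT)); last first.
  by apply: finite_image; exact: finite_finset.
move=> k kD; exists [ffun i => inord (k i)] => //.
apply/ffunP => i; rewrite !ffunE inordK// ltnS.
apply: (leq_trans (ltnW (kD i))).
exact: (leq_bigmax_cond (F := fun i => b i ^ g i)%N).
Qed.

Section regular_representation.
Variables (R : realType) (b : nat).
Hypothesis b2 : (2 <= b)%N.

Let b_gt0 : 0 < b%:R :> R.
Proof. by rewrite ltr0n (leq_trans _ b2). Qed.

Let bX_gt0 n : 0 < b%:R ^+ n :> R.
Proof. exact: exprn_gt0. Qed.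

Let S (d : nat -> nat) : R^nat := [series (d j)%:R / b%:R ^+ j.+1]_j.

Let SS d n : S d n.+1 = S d n + (d n)%:R / b%:R ^+ n.+1.
Proof. by rewrite /S /series/= big_nat_recr. Qed.

Let cvg_bV : (fun n => (b%:R ^- n : R)) @ \oo --> (0 : R).
Proof.
rewrite (_ : (fun n => _) = (fun n => (b%:R^-1 : R) ^+ n)); last first.
  by apply/funext => n; rewrite exprVn.
apply: cvg_expr; rewrite ger0_norm ?invr_ge0 ?ltW//.
by rewrite invf_lt1 ?ltr1n.
Qed.

Let cvg_subbV (c : R) : (fun n => c - b%:R ^- n : R) @ \oo --> c.
Proof.
have : (fun n => c - b%:R ^- n : R) @ \oo --> c - 0.
  by apply: cvgB; [exact: cvg_cst|exact: cvg_bV].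
by rewrite subr0.
Qed.

Let Q (d : nat -> nat) := fix Q n : nat :=
  if n is m.+1 then (Q m * b + d m)%N else 0%N.

Let SQ d n : S d n = (Q d n)%:R / b%:R ^+ n.
Proof.
elim: n => [|n IH]; first by rewrite /S /series/= big_nil mul0r.
rewrite SS IH /= natrD natrM exprS.
by field; rewrite (lt0r_neq0 (bX_gt0 n)) (lt0r_neq0 b_gt0).
Qed.

Let floor_digit (x : R) (j : nat) : nat :=
  (Num.truncn (x * b%:R ^+ j.+1) %% b)%N.

Let truncE (x : R) (n m : nat) :
  m%:R / b%:R ^+ n <= x < (m%:R + 1) / b%:R ^+ n ->
  Num.truncn (x * b%:R ^+ n) = m.
Proof.
rewrite ler_pdivrMr// ltr_pdivlMr// => /andP[h1 h2].
by apply: truncn_def; rewrite h1/= -natr1.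
Qed.

Let trunc_itv (x : R) n : 0 <= x ->
  (Num.truncn (x * b%:R ^+ n))%:R / b%:R ^+ n <= x
    < ((Num.truncn (x * b%:R ^+ n))%:R + 1) / b%:R ^+ n.
Proof.
move=> x0; rewrite ler_pdivrMr// ltr_pdivlMr// natr1.
by apply: truncn_itv; rewrite mulr_ge0// ltW.
Qed.

Let truncS (x : R) n : 0 <= x ->
  (Num.truncn (x * b%:R ^+ n.+1) %/ b)%N = Num.truncn (x * b%:R ^+ n).
Proof.
move=> x0; apply/esym/truncE.
have /andP[h1 h2] := trunc_itv n.+1 x0.
set q := Num.truncn _ in h1 h2 *.
have eq := divn_eq q b; have lt : (q %% b < b)%N by rewrite ltn_pmod// ltnW.
set r := (q %/ b)%N in eq *; set m := (q %% b)%N in eq lt.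
apply/andP; split.
  apply: le_trans h1; rewrite exprS eq ler_pdivlMr ?mulr_gt0//.
  rewrite natrD natrM [leLHS](_ : _ = r%:R * b%:R) ?lerDl//.
  by field; exact: lt0r_neq0.
apply: (lt_le_trans h2); rewrite exprS eq ler_pdivrMr ?mulr_gt0//.
rewrite [leRHS](_ : _ = r%:R * b%:R + b%:R); last first.
  by field; exact: lt0r_neq0.
by rewrite natrD natrM -addrA lerD2l natr1 ler_nat.
Qed.

Let QE (x : R) n : 0 <= x < 1 ->
  Q (floor_digit x) n = Num.truncn (x * b%:R ^+ n).
Proof.
move=> /andP[x0 x1]; elim: n => [|n IH] /=.
  by apply/esym/truncE; rewrite expr0 !divr1 add0r x0.
by rewrite IH -truncS// [RHS](divn_eq _ b).
Qed.

Lemma regular_repr_exists (x : R) :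
  0 <= x < 1 -> regular_repr b x (floor_digit x).
Proof.
move=> x01; have /andP[x0 x1] := x01.
have Sx n : S (floor_digit x) n <= x < S (floor_digit x) n + b%:R ^- n.
  by rewrite SQ QE// -[X in _ + X]mul1r -mulrDl; exact: trunc_itv.
split.
- by move=> j; rewrite ltn_pmod// ltnW.
- apply: (@squeeze_cvgr _ _ _ _ (fun n => x - b%:R ^- n) (fun=> x)).
  + by apply: nearW => n; have /andP[h1 h2] := Sx n; rewrite h1 andbT lerBlDr ltW.
  + exact: cvg_subbV.
  + exact: cvg_cst.
- move=> m; apply: contrapT => H.
  have dE j : (m <= j)%N -> floor_digit x j = b.-1.
    by move=> mj; apply/eqP/negP => /negP ne; apply: H; exists j.
  have E n : S (floor_digit x) (m + n)%N + b%:R ^- (m + n) =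
             S (floor_digit x) m + b%:R ^- m.
    elim: n => [|n IH]; first by rewrite addn0.
    rewrite addnS SS dE ?leq_addr// -IH -addrA; congr (_ + _).
    rewrite -subn1 natrB ?(ltnW b2)// exprS.
    by field; rewrite (lt0r_neq0 (bX_gt0 _)) (lt0r_neq0 b_gt0).
  have /andP[_ xm] := Sx m.
  suff : S (floor_digit x) m + b%:R ^- m <= x by rewrite leNgt xm.
  apply: (@ler_cvg_to _ \oo _ _
    (fun n => S (floor_digit x) m + b%:R ^- m - b%:R ^- n) (fun=> x) (S (floor_digit x) m + b%:R ^- m) x).
  + exact: cvg_subbV.
  + exact: cvg_cst.
  + near=> n; have mn : (m <= n)%N by near: n; exact: nbhs_infty_ge.
    rewrite -(E (n - m)%N) subnKC// addrK.
    by have /andP[] := Sx n.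
Unshelve. all: by end_near. Qed.

Lemma regular_repr_uniq (x : R) (d : nat -> nat) :
  regular_repr b x d -> d = floor_digit x.
Proof.
move=> [db Sx dn]; rewrite -/(S d) in Sx.
have Sle n m : (n <= m)%N -> S d n <= S d m.
  elim: m => [|m IH]; first by rewrite leqn0 => /eqP ->.
  rewrite leq_eqVlt => /predU1P[->//|]; rewrite ltnS => /IH h.
  by apply: (le_trans h); rewrite SS lerDl divr_ge0// ltW.
have step n : S d n.+1 + b%:R ^- n.+1 =
    S d n + b%:R ^- n - ((b.-1)%:R - (d n)%:R) / b%:R ^+ n.+1.
  rewrite SS -subn1 natrB ?(ltnW b2)// exprS.
  by field; rewrite (lt0r_neq0 (bX_gt0 _)) (lt0r_neq0 b_gt0).
have dle n : (d n)%:R <= (b.-1)%:R :> R.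
  by rewrite ler_nat -ltnS prednK ?db// ltnW.
have Tle n m : (n <= m)%N -> S d m + b%:R ^- m <= S d n + b%:R ^- n.
  elim: m => [|m IH]; first by rewrite leqn0 => /eqP ->.
  rewrite leq_eqVlt => /predU1P[->//|]; rewrite ltnS => /IH h.
  by apply: le_trans h; rewrite step gerBl divr_ge0 ?subr_ge0// ltW.
have Sx_le n : S d n <= x.
  apply: (@ler_cvg_to _ \oo _ _ (fun=> S d n) (S d)) => //.
    exact: cvg_cst.
  by near=> m; apply: Sle; near: m; exact: nbhs_infty_ge.
have Tx_ge n : x <= S d n + b%:R ^- n.
  apply: (@ler_cvg_to _ \oo _ _ (S d) (fun=> S d n + b%:R ^- n)) => //.
    exact: cvg_cst.
  near=> m; apply: (@le_trans _ _ (S d m + b%:R ^- m)).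
    by rewrite lerDl invr_ge0 ltW.
  by apply: Tle; near: m; exact: nbhs_infty_ge.
have Tx n : x < S d n + b%:R ^- n.
  have [j nj dj] := dn n.
  apply: (le_lt_trans (Tx_ge j.+1)); apply: lt_le_trans (Tle _ _ nj).
  rewrite step gtrBl divr_gt0// subr_gt0 lt_neqAle dle andbT.
  by rewrite eqr_nat.
have QdE n : Num.truncn (x * b%:R ^+ n) = Q d n.
  by apply: truncE; rewrite mulrDl mul1r -SQ Sx_le Tx.
apply/funext => j; rewrite /floor_digit QdE /= modnMDl modn_small.
Unshelve. all: by end_near. Qed.

Lemma real_digitP (x : R) : 0 <= x < 1 -> regular_repr b x (real_digit b x).
Proof. by move=> /regular_repr_exists h; exact: (xgetPex _ (ex_intro _ _ h)). Qed.

Lemma real_digitE (x : R) (j : nat) : 0 <= x < 1 ->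
  real_digit b x j = (Num.truncn (x * b%:R ^+ j.+1) %% b)%N.
Proof. by move=> /real_digitP/regular_repr_uniq ->. Qed.

End regular_representation.

Lemma lebesgue_tuple_set0 (R : realType) (s : nat) :
  lebesgue_tuple (set0 : set (s.-tuple R)) = 0%E.
Proof.
elim: s => [|s IH] /=; first exact: measure0.
rewrite /pushforward /product_measure1 preimage_set0.
rewrite integral0_eq// => t _ /=.
by rewrite xsection0 IH.
Qed.

Lemma lebesgue_tuple_box (R : realType) (s : nat) (u v : 'I_s -> R) :
  (forall i, u i <= v i) ->
  lebesgue_tuple (box u v) = (\prod_(i < s) (v i - u i))%:E.
Proof.
elim: s u v => [|s IH] u v uv.
  rewrite big_ord0 /= diracE mem_set//; first by case.
rewrite big_ord_recl /= /pushforward /product_measure1.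
set A := (X in xsection X).
pose u' i := u (lift ord0 i); pose v' i := v (lift ord0 i).
have bT t : xsection A t =
    if u ord0 <= t < v ord0 then box u' v' else set0.
  apply/seteqP; split => y; rewrite /xsection/= inE /A /box/=.
    move=> h; have := h ord0; rewrite tnth0 => -> i.
    by have := h (lift ord0 i); rewrite tnthS.
  case: ifP => // ht h i; case: (unliftP ord0 i) => [j|] ->.
    by rewrite tnthS; exact: h.
  by rewrite tnth0.
have p0 : (0 <= (\prod_(i < s) (v' i - u' i))%:E)%E.
  by rewrite lee_fin prodr_ge0// => i _; rewrite subr_ge0 uv.
rewrite (eq_integral (fun t : measurableTypeR R =>
    (\1_(`[u ord0, v ord0[%classic) t)%:E
      * (\prod_(i < s) (v' i - u' i))%:E)%E); last first.
  move=> t _ /=; rewrite bT indicE mem_setE in_itv/=.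
  case: ifP => _; first by rewrite mul1e IH// => i; exact: uv.
  rewrite mul0e.
  exact: lebesgue_tuple_set0.
rewrite ge0_integralZr//=; last first.
  apply/measurable_EFinP; exact: measurable_indic.
rewrite integral_indic ?setIT//.
rewrite EFinM; congr (_ * _)%E.
have /= -> := @lebesgue_measure_itv R `[u ord0, v ord0[; rewrite lte_fin.
case: ltP => // vu; suff -> : v ord0 = u ord0 by rewrite subrr.
by apply/eqP; rewrite eq_le vu uv.
Qed.

(* Main.v *)
(** Both Walsh and b-adic functions have the form
    [e (\sum_j k_j (d_j / b + h_j (d_0, ..., d_{j-1})))], where the [d_j] are
    the digits of x and the shift [h_j] only sees earlier digits ([h = 0] for
    Walsh functions).  At the first digit where two cells of the grid
    [b ^- g Z] differ the shifts cancel and a geometric sum vanishes, so these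
    functions are orthogonal in k and every function that is constant on grid
    cells has a finite expansion.  The same form makes the Fourier sum over an
    initial segment of cells collapse to a geometric sum in the leading digit
    of k, whence coefficients of anchored grid intervals are at most [rho_star]
    and those of arbitrary ones at most [rho].  Finally any box is enclosed
    between two grid boxes whose volumes differ by at most epsilon. *)

Require Import Defs.
From HB Require Import structures.
From mathcomp Require Import all_boot all_order all_algebra.
From mathcomp Require Import complex finmap.
From mathcomp Require Import all_classical all_reals all_analysis.
From mathcomp Require Import zify ring lra.

Set Implicit Arguments.
Unset Strict Implicit.
Unset Printing Implicit Defensive.

Import Order.TTheory GRing.Theory Num.Theory.
Import numFieldNormedType.Exports.

Local Open Scope classical_set_scope.
Local Open Scope ring_scope.

Notation normc := ComplexField.Normc.normc.

(** * Modulus and products of the exponentials [expi2pi] *)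

Section unit_circle.
Variable R : realType.
Implicit Types (x y : R) (z : R[i]).

Lemma ler_normc_sum (I : Type) (r : seq I) (P : pred I) (F : I -> R[i]) :
  normc (\sum_(i <- r | P i) F i) <= \sum_(i <- r | P i) normc (F i).
Proof.
elim/big_rec2: _ => [|i y z _ h]; first by rewrite ComplexField.Normc.normc0.
by rewrite (le_trans (le_normcD _ _))// lerD2l.
Qed.

Lemma normc_prod (I : Type) (r : seq I) (P : pred I) (F : I -> R[i]) :
  normc (\prod_(i <- r | P i) F i) = \prod_(i <- r | P i) normc (F i).
Proof.
elim/big_rec2: _ => [|i y z _ <-]; first exact: ComplexField.Normc.normc1.
by rewrite ComplexField.Normc.normcM.
Qed.

Lemma normc_real x : normc (x%:C)%C = `|x|.
Proof. by rewrite /= expr0n /= addr0 sqrtr_sqr. Qed.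

Lemma expi2piD x y : expi2pi (x + y) = expi2pi x * expi2pi y.
Proof.
by rewrite /expi2pi mulrDr cosD sinD; simpc; congr (_ +i* _)%C; ring.
Qed.

Lemma expi2pi0 : expi2pi 0 = 1 :> R[i].
Proof. by rewrite /expi2pi mulr0 cos0 sin0. Qed.

Lemma expi2pi_sum (I : Type) (r : seq I) (P : pred I) (F : I -> R) :
  expi2pi (\sum_(i <- r | P i) F i) = \prod_(i <- r | P i) expi2pi (F i).
Proof.
by apply: (big_morph (@expi2pi R)); [exact: expi2piD|exact: expi2pi0].
Qed.

Lemma expi2piN x : expi2pi (- x) = (expi2pi x)^-1.
Proof.
have h : expi2pi x * expi2pi (- x) = 1 by rewrite -expi2piD subrr expi2pi0.
have x0 : expi2pi x != 0.
  by apply/eqP => x0; move: h => /eqP; rewrite x0 mul0r eq_sym oner_eq0.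
by apply: (mulfI x0); rewrite h divff.
Qed.

Lemma expi2pi1 : expi2pi 1 = 1 :> R[i].
Proof. by rewrite /expi2pi mulr1 mulr_natl cos2pi sin2pi. Qed.

Lemma expi2piMn x n : expi2pi (n%:R * x) = expi2pi x ^+ n.
Proof.
by elim: n => [|n IH]; rewrite ?mul0r ?expi2pi0// -natr1 mulrDl mul1r expi2piD IH exprSr.
Qed.

Lemma expi2pi_nat n : expi2pi n%:R = 1 :> R[i].
Proof. by rewrite -[_%:R]mulr1 expi2piMn expi2pi1 expr1n. Qed.

Lemma normc_expi2pi x : normc (expi2pi x) = 1.
Proof. by rewrite /= cos2Dsin2 sqrtr1. Qed.

(** The double-angle formulas reduce the squared modulus to [4 * s ^+ 2]; this is the origin of the
    sine in [rho1]. *)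
Lemma normc_expi2pi_sub1 x : normc (expi2pi x - 1) = 2 * `|sin (pi * x)|.
Proof.
rewrite /expi2pi /= subr0 -mulrA mulr_natl mulr2n cosD sinD.
rewrite -[RHS]ger0_norm ?mulr_ge0// -sqrtr_sqr; congr Num.sqrt.
have := cos2Dsin2 (pi * x); set c := cos _; set s := sin _ => h.
rewrite exprMn -normrX ger0_norm ?sqr_ge0//.
have c2 : c ^+ 2 = 1 - s ^+ 2 by lra.
have -> : (c * c - s * s - 1) ^+ 2 + (s * c + c * s) ^+ 2 =
  (c ^+ 2 - s ^+ 2 - 1) ^+ 2 + 4 * s ^+ 2 * c ^+ 2 by ring.
by rewrite c2; ring.
Qed.

Lemma normc_expi2pi_sub1_gt0 x : 0 < `|x| < 1 -> 0 < normc (expi2pi x - 1).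
Proof.
move=> /andP[x0 x1]; rewrite normc_expi2pi_sub1 mulr_gt0//.
have h : 0 < sin (pi * `|x|).
  by apply: sin_gt0_pi; rewrite mulr_gt0 ?pi_gt0//= gtr_pMr ?pi_gt0.
have [x'0|x'0] := leP 0 x; first by rewrite normr_gt0 -(ger0_norm x'0) lt0r_neq0.
by rewrite normr_gt0 -oppr_eq0 -sinN -mulrN -ltr0_norm// lt0r_neq0.
Qed.

Lemma expi2pi_neq1 x : 0 < `|x| < 1 -> expi2pi x != 1.
Proof.
move=> /normc_expi2pi_sub1_gt0; apply: contraTneq => ->.
by rewrite subrr ComplexField.Normc.normc0 ltxx.
Qed.

(** The ratio [expi2pi (x / b%:R)] is not 1 but its [b]-th power is, so the geometric sum vanishes.
    The hypothesis [expi2pi x = 1] stands for integrality of [x]. *)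
Lemma sum_expi2pi_eq0 (b : nat) x : 0 < `|x| < b%:R ->
  expi2pi x = 1 -> \sum_(d < b) expi2pi (d%:R * (x / b%:R)) = 0.
Proof.
move=> /andP[x0 xb] e1; have b0 : 0 < b%:R :> R by exact: lt_trans xb.
have z1 : expi2pi (x / b%:R) != 1.
  apply: expi2pi_neq1; rewrite normrM normfV (ger0_norm (ltW b0)).
  by rewrite divr_gt0//= ltr_pdivrMr// mul1r.
under eq_bigr do rewrite expi2piMn.
have := subrX1 (expi2pi (x / b%:R)) b.
rewrite -expi2piMn mulrC divfK ?lt0r_neq0// e1 subrr => /esym/eqP.
by rewrite mulf_eq0 subr_eq0 (negPf z1) => /eqP.
Qed.

End unit_circle.

(** * Base-[b] digits of integers and of grid cells *)

Section digits.
Variable b : nat.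
Hypothesis b2 : (2 <= b)%N.

Let b0 : (0 < b)%N. Proof. exact: ltnW. Qed.

Lemma ndigits_le k g : (k < b ^ g)%N -> (ndigits b k <= g)%N.
Proof.
rewrite /ndigits; case: eqP => // /eqP k0 kg.
rewrite -(ltn_exp2l _ _ b2); apply: leq_ltn_trans kg.
by rewrite trunc_logP// lt0n.
Qed.

Lemma leading_digit k : (0 < k)%N ->
  [/\ (0 < ndigits b k)%N, (0 < nat_digit b k (ndigits b k).-1)%N &
      (nat_digit b k (ndigits b k).-1 < b)%N].
Proof.
move=> k0; rewrite /ndigits gtn_eqF//=; split => //; last by rewrite ltn_pmod.
have /andP[h1 h2] := trunc_log_bounds b2 k0.
rewrite /nat_digit modn_small; first by rewrite divn_gt0// expn_gt0 b0.
by rewrite ltn_divLR ?expn_gt0 ?b0// -expnS.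
Qed.

Lemma nat_digitMD q r g j : (r < b ^ g)%N -> (q < b)%N -> (j <= g)%N ->
  nat_digit b (r + q * b ^ g) j = if j == g then q else nat_digit b r j.
Proof.
move=> rg qb jg; rewrite /nat_digit addnC; case: eqP => [->|/eqP jn].
  by rewrite divnMDl ?expn_gt0 ?b0// (divn_small rg) addn0 modn_small.
have -> : (b ^ g = b ^ (g - j.+1) * b * b ^ j)%N.
  by rewrite -mulnA -expnS -expnD subnK// ltn_neqAle jn.
by rewrite !mulnA divnMDl ?expn_gt0 ?b0// modnMDl.
Qed.

(** Each [k < b ^ g.+1] is uniquely [r + q * b ^ g], so the top digit [q] splits off as an
    independent factor. *)
Lemma sum_prod_digits (K : comPzRingType) g (E : nat -> nat -> K) :
  \sum_(k < b ^ g) \prod_(j < g) E j (nat_digit b k j) =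
  \prod_(j < g) \sum_(d < b) E j d.
Proof.
elim: g => [|g IH]; first by rewrite big_ord0 big_ord1 big_ord0.
rewrite big_ord_recr/= -IH.
rewrite -(big_mkord xpredT (fun k => \prod_(j < g.+1) E j (nat_digit b k j))).
rewrite expnS big_nat_mul big_mkord mulr_sumr; apply: eq_bigr => q _.
rewrite mulSn -{1}[(q * _)%N]add0n big_addn addnK big_mkord mulr_suml.
apply: eq_bigr => r _; rewrite big_ord_recr/=; congr (_ * _).
  apply: eq_bigr => j _; rewrite nat_digitMD ?(ltnW (ltn_ord j))//.
  by rewrite ltn_eqF.
by rewrite nat_digitMD// eqxx.
Qed.

(* The first g digits after the radix point of the points of the cell
   [a / b ^ g, (a + 1) / b ^ g). *)
Definition cell_digit g a j : nat := ((a %/ b ^ (g - j.+1)) %% b)%N.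

Lemma cell_digit_neq g a a' : (a < b ^ g)%N -> (a' < b ^ g)%N -> a != a' ->
  exists2 j, (j < g)%N & cell_digit g a j != cell_digit g a' j /\
    forall i, (i < j)%N -> cell_digit g a i = cell_digit g a' i.
Proof.
move=> ag a'g aa'.
have [/existsP ex|] :=
  boolP [exists j : 'I_g, cell_digit g a j != cell_digit g a' j].
  have ex' : exists j, (j < g)%N && (cell_digit g a j != cell_digit g a' j).
    by have [j hj] := ex; exists j; rewrite ltn_ord.
  case: (ex_minnP ex') => j /andP[jg hj] jmin; exists j => //; split => // i ij.
  apply/eqP/negPn/negP => hi; have := jmin i.
  by rewrite hi (ltn_trans ij jg) leqNgt ij => /(_ isT).
rewrite negb_exists => /forallP eqd; case/eqP: aa'.
(* The quotient by [b ^ (g - j)] is the number formed by the first [j] digits; at [j = g] it is the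
   cell index itself. *)
suff E j : (j <= g)%N -> (a %/ b ^ (g - j) = a' %/ b ^ (g - j))%N.
  by have := E g (leqnn g); rewrite subnn !divn1.
elim: j => [|j IH] jg; first by rewrite subn0 !divn_small.
have := eqd (Ordinal jg); rewrite negbK /cell_digit /= => /eqP dE.
rewrite (divn_eq (a %/ _)%N b) (divn_eq (a' %/ _)%N b) dE.
by rewrite -!divnMA -expnSr subnSK// IH// ltnW.
Qed.

Lemma truncn_divn (R : realType) (y : R) (d : nat) : 0 <= y -> (0 < d)%N ->
  (Num.truncn y %/ d)%N = Num.truncn (y / d%:R).
Proof.
move=> y0 d0; have d0' : 0 < d%:R :> R by rewrite ltr0n.
apply/esym/truncn_def; rewrite ler_pdivlMr// ltr_pdivrMr// -!natrM.
have /andP[h1 h2] := truncn_itv y0; apply/andP; split.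
  by apply: le_trans h1; rewrite ler_nat leq_trunc_div.
by apply: (lt_le_trans h2); rewrite ler_nat ltn_ceil.
Qed.

(** Floors nest: dividing the floor of [x * b ^ g] by [b ^ (g - j.+1)] gives the floor of
    [x * b ^ j.+1]. Hence functions of the first [g] digits are constant on cells. *)
Lemma real_digit_cell (R : realType) (x : R) g j : 0 <= x < 1 -> (j < g)%N ->
  real_digit b x j = cell_digit g (Num.truncn (x * (b ^ g)%:R)) j.
Proof.
move=> x01 jg; rewrite real_digitE// /cell_digit.
have /andP[x0 _] := x01.
rewrite truncn_divn ?mulr_ge0// ?expn_gt0 ?b0//.
rewrite -{1}(subnKC jg) expnD natrM mulrA mulfK ?natrX//.
by rewrite expf_neq0// pnatr_eq0 -lt0n.
Qed.

End digits.

(** * Orthogonality and finite expansions for characters with causal shifts *)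

Section characters.
Variables (R : realType) (b : nat).
Hypothesis b2 : (2 <= b)%N.
Variable h : nat -> (nat -> nat) -> R.
Hypothesis h_causal : forall j d d',
  (forall i, (i < j)%N -> d i = d' i) -> h j d = h j d'.

Let b0 : 0 < b%:R :> R. Proof. by rewrite ltr0n ltnW. Qed.

Definition phase (d : nat -> nat) (j : nat) : R := (d j)%:R / b%:R + h j d.

(** A fixed number [g] of digits, instead of [ndigits b k], makes sums over all [k < b ^ g] factor
    over digit positions; [chi_ndigits] shows that the value is the same. *)
Definition chi (g k : nat) (d : nat -> nat) : R[i] :=
  expi2pi (\sum_(j < g) (nat_digit b k j)%:R * phase d j).

Lemma eq_phase j d d' : (forall i, (i <= j)%N -> d i = d' i) ->
  phase d j = phase d' j.
Proof.
move=> dd'; rewrite /phase dd'//; congr (_ + _).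
by apply: h_causal => i ij; rewrite dd'// ltnW.
Qed.

Lemma eq_chi g k d d' : (forall i, (i < g)%N -> d i = d' i) ->
  chi g k d = chi g k d'.
Proof.
move=> dd'; congr expi2pi; apply: eq_bigr => j _; congr (_ * _).
by apply: eq_phase => i ij; apply: dd'; exact: leq_ltn_trans (ltn_ord j).
Qed.

Lemma chi_ndigits g k d : (ndigits b k <= g)%N -> chi g k d = chi (ndigits b k) k d.
Proof.
move=> kg; congr expi2pi; rewrite -(subnKC kg) big_split_ord/=.
rewrite [X in _ + X]big1 ?addr0// => j _.
by rewrite nat_digit_eq0 ?mul0r// leq_addr.
Qed.

Lemma chi0 g d : chi g 0 d = 1.
Proof.
rewrite /chi big1 ?expi2pi0// => j _.
by rewrite /nat_digit div0n mod0n mul0r.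
Qed.

(** The sum over [k] factors over digit positions, so one vanishing factor suffices. Orthogonality
    between cells, rather than between frequencies, is what inverts [coef]. *)
Lemma chi_orthogonal g a a' : (a < b ^ g)%N -> (a' < b ^ g)%N ->
  \sum_(k < b ^ g) chi g k (cell_digit b g a) / chi g k (cell_digit b g a') =
  (b ^ g * (a == a'))%:R.
Proof.
move=> ag a'g; have [<-|aa'] := eqVneq a a'.
  under eq_bigr do rewrite -expi2piN -expi2piD subrr expi2pi0.
  by rewrite sumr_const card_ord muln1.
rewrite muln0.
have [j jg [jn ji]] := cell_digit_neq ag a'g aa'.
set d := cell_digit b g a in jn ji *; set d' := cell_digit b g a' in jn ji *.
pose E j n := expi2pi (n%:R * (phase d j - phase d' j)).
rewrite (eq_bigr (fun k : 'I_ _ => \prod_(j < g) E j (nat_digit b k j))); last first.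
  move=> k _; rewrite /chi -expi2piN -expi2piD -sumrB expi2pi_sum.
  by apply: eq_bigr => i _; rewrite /E mulrBr.
rewrite (sum_prod_digits b2) (bigD1 (Ordinal jg))//= /E /phase.
(* The earlier digits agree, so the shifts cancel and a nonzero digit difference of modulus below
   [b], divided by [b], remains. *)
rewrite (h_causal ji) opprD addrACA subrr addr0 -mulrBl sum_expi2pi_eq0 ?mul0r//.
  rewrite normr_gt0 subr_eq0 eqr_nat jn/= ltr_norml.
  have h1 : (d j)%:R < b%:R :> R by rewrite ltr_nat ltn_pmod// ltnW.
  have h2 : (d' j)%:R < b%:R :> R by rewrite ltr_nat ltn_pmod// ltnW.
  have h3 : 0 <= (d j)%:R :> R by [].
  have h4 : 0 <= (d' j)%:R :> R by [].
  by apply/andP; split; lra.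
by rewrite expi2piD expi2piN !expi2pi_nat divr1.
Qed.

(** The Fourier coefficient of the step function with value [f a] on cell [a]: as [chi] has modulus
    1, dividing by it is conjugation. *)
Definition coef (g : nat) (f : nat -> R[i]) (k : nat) : R[i] :=
  (b ^ g)%:R^-1 * \sum_(a < b ^ g) f a / chi g k (cell_digit b g a).

Lemma coef_expansion g f a : (a < b ^ g)%N ->
  f a = \sum_(k < b ^ g) coef g f k * chi g k (cell_digit b g a).
Proof.
move=> ag; have M0 : (b ^ g)%:R != 0 :> R[i].
  by rewrite pnatr_eq0 -lt0n expn_gt0 ltnW.
under eq_bigr do rewrite -mulrA mulr_suml.
rewrite -mulr_sumr exchange_big/= (bigD1 (Ordinal ag))//=.
rewrite [X in _ + X]big1 ?addr0; last first.
  move=> a' a'a; under eq_bigr do rewrite -mulrA [_^-1 * _]mulrC.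
  have /negPf aa' : a != a' by rewrite eq_sym; exact: a'a.
  by rewrite -mulr_sumr chi_orthogonal// aa' muln0 mulr0.
under eq_bigr do rewrite -mulrA [_^-1 * _]mulrC.
by rewrite -mulr_sumr chi_orthogonal// eqxx muln1 mulrCA mulVf// mulr1.
Qed.

End characters.

(** * Geometric sums with blockwise constant coefficients *)

Section partial_sums.
Variable R : realType.

(* Within a block of constant [q %/ b] the sum over q is geometric, and it
   vanishes on full blocks since z ^+ b = 1; the closed form interpolates
   linearly between consecutive values of n = m %/ P. *)
Lemma sum_blocksE (K : comNzRingType) (F : nat -> K) (z : K) (b P m : nat) :
  (0 < b)%N -> (0 < P)%N -> z ^+ b = 1 ->
  (z - 1) * \sum_(a < m) (F (a %/ P %/ b)%N * z ^+ (a %/ P)) =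
  F (m %/ P %/ b)%N * ((P - m %% P)%:R * (z ^+ (m %/ P) - 1)
                       + (m %% P)%:R * (z ^+ (m %/ P).+1 - 1)).
Proof.
move=> b0 P0 zb; elim: m => [|m IH].
  by rewrite big_ord0 div0n mod0n expr0 subrr !(mulr0, mul0r, addr0).
rewrite big_ord_recr/= mulrDr IH modnS (divnS m P0).
have rP : (m %% P < P)%N by rewrite ltn_pmod.
case: ifPn => [dv|ndv]; last first.
  have {}rP : (m %% P < P.-1)%N.
    rewrite -ltnS prednK// ltn_neqAle rP andbT; apply: contra ndv => /eqP e.
    by rewrite (divn_eq m P) -addnS e dvdn_add ?dvdn_mull.
  rewrite add0n exprS !natrB ?(ltnW rP)//; last 2 first.
    - exact: leq_trans rP (leq_pred _).
    - by apply: ltnW; exact: leq_trans rP (leq_pred _).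
  by rewrite -natr1; ring.
have rE : (m %% P).+1 = P.
  apply/eqP; rewrite eqn_leq rP/=; apply: dvdn_leq => //.
  by move: dv; rewrite {1}(divn_eq m P) -addnS dvdn_addr// dvdn_mull.
have -> : (P - m %% P)%N = 1%N by lia.
have PE : P%:R = (m %% P)%:R + 1 :> K by rewrite natr1 rE.
rewrite add1n subn0 PE.
(* The value of [F] can change only when [b] divides the new quotient; then [z ^+ (m %/ P).+1 = 1]
   and both sides vanish. *)
have [bn|bn] := boolP (b %| (m %/ P).+1)%N.
  have z1 : z ^+ (m %/ P).+1 = 1.
    by case/dvdnP: bn => c ->; rewrite mulnC exprM zb expr1n.
  have z2 : z * z ^+ (m %/ P) = 1 by rewrite -exprS.
  rewrite z1 subrr !(mulr0, mul0r, addr0) mul1r.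
  rewrite mulrBl mul1r [z * _]mulrCA z2; ring.
by rewrite divnS// (negPf bn) add0n exprS -natr1; ring.
Qed.

(** In the closed form the weights [P - m %% P] and [m %% P] add up to [P], and each [z ^+ n - 1]
    has modulus at most 2. *)
Lemma normc_sum_blocks (F : nat -> R[i]) (z : R[i]) (b P m : nat) :
  (0 < b)%N -> (0 < P)%N -> z ^+ b = 1 -> normc z = 1 ->
  (forall q, normc (F q) = 1) ->
  normc (z - 1) * normc (\sum_(a < m) (F (a %/ P %/ b)%N * z ^+ (a %/ P)))
    <= 2 * P%:R.
Proof.
move=> b0 P0 zb z1 F1.
rewrite -ComplexField.Normc.normcM sum_blocksE// ComplexField.Normc.normcM F1 mul1r.
have zX n : normc (z ^+ n - 1) <= 2.
  apply: le_trans (le_normcD _ _) _; rewrite normcN ComplexField.Normc.normc1.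
  have -> : normc (z ^+ n) = 1; last by lra.
  elim: n => [|n IH]; first exact: ComplexField.Normc.normc1.
  by rewrite exprS ComplexField.Normc.normcM z1 IH mulr1.
have nN n : normc (n%:R : R[i]) = n%:R.
  by rewrite -(rmorph_nat (real_complex R)) normc_real ger0_norm.
apply: le_trans (le_normcD _ _) _; rewrite !ComplexField.Normc.normcM !nN.
have r : (m %% P <= P)%N by rewrite ltnW// ltn_pmod.
have -> : 2 * P%:R = (P - m %% P)%:R * 2 + (m %% P)%:R * 2 :> R.
  by rewrite -mulrDl -natrD subnK// mulrC.
by rewrite lerD// ler_wpM2l.
Qed.

End partial_sums.

(** * Bounds for the Fourier coefficients of grid intervals *)

Section coefficients.
Variables (R : realType) (b : nat).
Hypothesis b2 : (2 <= b)%N.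
Variable h : nat -> (nat -> nat) -> R.
Hypothesis h_causal : forall j d d',
  (forall i, (i < j)%N -> d i = d' i) -> h j d = h j d'.

Let b0 : 0 < b%:R :> R. Proof. by rewrite ltr0n ltnW. Qed.

Lemma sin_leading_digit_gt0 k : (0 < k)%N ->
  0 < sin (pi * (nat_digit b k (ndigits b k).-1)%:R / b%:R) :> R.
Proof.
move=> k0; have [_ c0 cb] := leading_digit b2 k0.
apply: sin_gt0_pi; rewrite -mulrA mulr_gt0 ?pi_gt0 ?divr_gt0 ?ltr0n ?(ltnW b2)//=.
by rewrite gtr_pMr ?pi_gt0// ltr_pdivrMr// mul1r ltr_nat.
Qed.

(** With [t.+1] digits in [k], [normc_sum_blocks] bounds the sum by [2 * P] over [normc (z - 1)],
    that is by [P] over the sine. Dividing by [b ^ g], which is [P * b ^ t.+1], leaves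
    [rho1_star]. *)
Lemma normc_partial_sum g k m : (0 < k)%N -> (k < b ^ g)%N ->
  normc ((b ^ g)%:R^-1 * \sum_(a < m) (chi b h g k (cell_digit b g a))^-1)
    <= rho1_star R b k.
Proof.
move=> k0 kg; have tg := ndigits_le b2 kg.
have [t0 c0 cb] := leading_digit b2 k0.
have s0 := sin_leading_digit_gt0 k0.
rewrite /rho1_star /rho1 gtn_eqF//=.
move tE : (ndigits b k) => t in tg t0 c0 cb s0 *.
case: t => // t in tE tg t0 c0 cb s0 *; rewrite /= in c0 cb s0 *.
set c := nat_digit b k t in c0 cb s0 *.
(* Runs of [P] consecutive cells share their first [t.+1] digits, the only ones that [chi] sees. *)
pose P := (b ^ (g - t.+1))%N.
have P0 : (0 < P)%N by rewrite expn_gt0 ltnW.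
(* All that depends on the first [t] cell digits only: the lower digits of [k] and the shift
   attached to its leading digit. *)
pose F q := (expi2pi (\sum_(j < t) (nat_digit b k j)%:R *
    phase b h (cell_digit b t q) j + c%:R * h t (cell_digit b t q)))^-1.
pose z := (expi2pi (c%:R / b%:R : R))^-1.
have zb : z ^+ b = 1.
  by rewrite /z exprVn -expi2piMn mulrC divfK ?lt0r_neq0// expi2pi_nat invr1.
have chiE a : (chi b h g k (cell_digit b g a))^-1 =
    F (a %/ P %/ b)%N * z ^+ (a %/ P).
  rewrite (chi_ndigits b2) ?tE// /chi big_ord_recr/= /F.
  have dE j : (j < t)%N -> cell_digit b g a j = cell_digit b t (a %/ P %/ b) j.
    move=> jt; rewrite /cell_digit /P -!divnMA -expnS -expnD.
    by congr ((_ %/ b ^ _) %% _)%N; lia.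
  (* As [z ^+ b = 1], the exponent may be reduced modulo [b], which turns it into digit [t] of the
     cell. *)
  rewrite -(expr_mod _ zb) /z -/c exprVn -invfM -expi2piMn -expi2piD.
  congr (expi2pi _)^-1; rewrite -addrA; congr (_ + _).
    apply: eq_bigr => j _; congr (_ * _).
    apply: (eq_phase b h_causal) => i ij; apply: dE.
    exact: leq_ltn_trans (ltn_ord j).
  rewrite /phase mulrDr addrC (h_causal dE); congr (_ + _).
  by rewrite /cell_digit -/P; ring.
under eq_bigr do rewrite chiE.
have z1 : normc z = 1 by rewrite ComplexField.Normc.normcV normc_expi2pi invr1.
have F1 q : normc (F q) = 1 by rewrite ComplexField.Normc.normcV normc_expi2pi invr1.
have := normc_sum_blocks m (ltnW b2) P0 zb z1 F1.
rewrite {1}/z -expi2piN normc_expi2pi_sub1 mulrN sinN normrN mulrA gtr0_norm//.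
rewrite ComplexField.Normc.normcM ComplexField.Normc.normcV.
rewrite -(rmorph_nat (real_complex R)) normc_real ger0_norm//.
set S := normc _; set s := sin _ in s0 * => le.
have -> : (b ^ g)%:R = P%:R * b%:R ^+ t.+1 :> R.
  by rewrite -natrX -natrM -expnD subnK.
have Pp : 0 < P%:R :> R by rewrite ltr0n.
have bt : 0 < b%:R ^+ t.+1 :> R by rewrite exprn_gt0.
rewrite [leRHS](_ : _ = (b%:R ^+ t.+1 * s)^-1); last first.
  by field; rewrite !lt0r_neq0.
rewrite mulrC ler_pdivrMr ?mulr_gt0// invfM.
rewrite [leRHS](_ : _ = P%:R / s); last by field; rewrite !lt0r_neq0.
by rewrite ler_pdivlMr//; lra.
Qed.

Definition cell_itv (l m a : nat) : R[i] := (l <= a < m)%N%:R.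

Lemma sum_cell_itv l m M (G : nat -> R[i]) : (l <= m)%N -> (m <= M)%N ->
  \sum_(a < M) cell_itv l m a * G a = \sum_(a < m) G a - \sum_(a < l) G a.
Proof.
move=> lm mM; have E1 : \sum_(0 <= a < l) cell_itv l m a * G a = 0.
  rewrite big_nat_cond big1// => a; rewrite andbT => /andP[_ al].
  by rewrite /cell_itv [(l <= a)%N]leqNgt al mul0r.
have E2 : \sum_(l <= a < m) cell_itv l m a * G a = \sum_(l <= a < m) G a.
  by apply: eq_big_nat => a; rewrite /cell_itv => ->; rewrite mul1r.
have E3 : \sum_(m <= a < M) cell_itv l m a * G a = 0.
  rewrite big_nat_cond big1// => a; rewrite andbT => /andP[ma _].
  by rewrite /cell_itv [(a < m)%N]ltnNge ma andbF mul0r.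
rewrite -!(big_mkord xpredT G) -(big_mkord xpredT (fun a => cell_itv l m a * G a)).
rewrite (big_cat_nat (leq0n m) mM) E3 [LHS]addr0.
rewrite (big_cat_nat (leq0n l) lm) E1 [LHS]add0r E2.
by rewrite (big_cat_nat (leq0n l) lm) addrAC subrr [RHS]add0r.
Qed.

Lemma coef_cell_itvE g l m k : (l <= m)%N -> (m <= b ^ g)%N ->
  coef b h g (cell_itv l m) k =
  (b ^ g)%:R^-1 * \sum_(a < m) (chi b h g k (cell_digit b g a))^-1 -
  (b ^ g)%:R^-1 * \sum_(a < l) (chi b h g k (cell_digit b g a))^-1.
Proof.
move=> lm mM; rewrite /coef.
by rewrite (sum_cell_itv (fun a => (chi b h g k (cell_digit b g a))^-1))// mulrBr.
Qed.

(** All characters are 1 at frequency 0; this coefficient later cancels the volume of the grid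
    box. *)
Lemma coef_cell_itv0 g l m : (l <= m)%N -> (m <= b ^ g)%N ->
  coef b h g (cell_itv l m) 0 = ((m - l)%:R / (b ^ g)%:R).
Proof.
move=> lm mM; rewrite coef_cell_itvE// -mulrBr mulrC natrB//.
have E n : \sum_(a < n) (chi b h g 0 (cell_digit b g a))^-1 = n%:R.
  by under eq_bigr do rewrite chi0 invr1; rewrite sumr_const card_ord.
by rewrite !E.
Qed.

(** For [k > 0] an interval is a difference of two initial segments, each costing [rho1_star]: hence
    the factor 2 between the weights. For [k = 0] the coefficient is a length at most 1. *)
Lemma normc_coef_cell_itv g l m k :
  (l <= m)%N -> (m <= b ^ g)%N -> (k < b ^ g)%N ->
  normc (coef b h g (cell_itv l m) k) <= rho1 R b k.
Proof.
move=> lm mM kM; have [->|] := posnP k.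
  rewrite coef_cell_itv0// /rho1/= -!(rmorph_nat (real_complex R)) -fmorphV -rmorphM.
  rewrite normc_real ger0_norm// ler_pdivrMr ?ltr0n ?expn_gt0 ?(ltnW b2)//.
  by rewrite mul1r ler_nat; apply: leq_trans mM; rewrite leq_subr.
move=> k0; rewrite coef_cell_itvE//.
apply: le_trans (le_normcD _ _) _; rewrite normcN.
have -> : rho1 R b k = rho1_star R b k + rho1_star R b k.
  by rewrite /rho1_star gtn_eqF//; field.
by rewrite lerD// normc_partial_sum.
Qed.

(** The subtracted segment is empty here, so a single partial sum remains. *)
Lemma normc_coef_cell_itv0 g m k : (m <= b ^ g)%N -> (k < b ^ g)%N ->
  normc (coef b h g (cell_itv 0 m) k) <= rho1_star R b k.
Proof.
move=> mM kM; have [->|k0] := posnP k; last first.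
  by rewrite coef_cell_itvE// big_ord0 mulr0 subr0 normc_partial_sum.
(* At [k = 0] both weights equal 1. *)
by have := normc_coef_cell_itv (leq0n m) mM (leq_ltn_trans (leq0n k) kM).
Qed.

End coefficients.

(** * Walsh and [b]-adic functions as such characters *)

Section function_systems.
Variables (R : realType) (b : nat).
Hypothesis b2 : (2 <= b)%N.

Definition walsh_shift (j : nat) (d : nat -> nat) : R := 0.

(** In the phase of [badic], digit [j] of [k] meets [d i] with factor [b^(i-j-1)]: [i = j] gives the
    main term of [phase], [i > j] an integer, and [i < j] this shift. *)
Definition badic_shift (j : nat) (d : nat -> nat) : R :=
  (\sum_(i < j) d i * b ^ i)%N%:R / b%:R ^+ j.+1.

Lemma badic_shift_causal j d d' : (forall i, (i < j)%N -> d i = d' i) ->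
  badic_shift j d = badic_shift j d'.
Proof.
by move=> dd'; congr (_%:R / _); apply: eq_bigr => i _; rewrite dd'.
Qed.

Lemma walshE g k (x : R) : (k < b ^ g)%N ->
  walsh b k x = chi b walsh_shift g k (real_digit b x).
Proof.
move=> kg; rewrite (chi_ndigits b2) ?ndigits_le//; congr expi2pi.
rewrite natr_sum mulr_sumr; apply: eq_bigr => j _.
by rewrite /phase addr0 natrM mulrC mulrA.
Qed.

Lemma badicE g k (x : R) : (k < b ^ g)%N ->
  badic b k x = chi b badic_shift g k (real_digit b x).
Proof.
move=> kg; rewrite (chi_ndigits b2) ?ndigits_le// /badic /chi /radical_inverse.
set d := real_digit b x; set t := ndigits b k; have b0 : b%:R != 0 :> R.
  by rewrite pnatr_eq0 -lt0n ltnW.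
rewrite mulr_suml !expi2pi_sum; apply: eq_bigr => j _.
set kj := nat_digit b k j.
(* The digits past [j] contribute a multiple of [b ^ j.+1], which becomes an integer after division
   and disappears under [expi2pi]. *)
have split_sum n : (\sum_(i < j.+1 + n) d i * b ^ i =
    \sum_(i < j) d i * b ^ i + d j * b ^ j +
    b ^ j.+1 * \sum_(i < n) d (j.+1 + i) * b ^ i)%N.
  rewrite big_split_ord big_ord_recr/=; congr (_ + _)%N.
  by rewrite big_distrr/=; apply: eq_bigr => i _; rewrite expnD mulnCA.
have := split_sum (t - j.+1)%N; rewrite subnKC// => ->.
rewrite !natrD [in X in _ * X]natrM natrX.
rewrite [X in expi2pi X](_ : _ = kj%:R * phase b badic_shift d j +
   (kj * \sum_(i < t - j.+1) d (j.+1 + i) * b ^ i)%N%:R).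
  by rewrite expi2piD expi2pi_nat mulr1.
rewrite /phase /badic_shift !natrM natrX exprS.
by field; rewrite b0 expf_neq0.
Qed.

End function_systems.

(** * Sums over the frequency domain [Delta] *)

Section products.
Variables (s : nat) (b g : 'I_s -> nat).

(** Distributivity. The ranges vary with [i], so every sum is first widened to the common bound [B];
    [Delta] is then an injective image of a family of finite functions into ['I_B]. *)
Lemma prod_sum_Delta (K : comPzRingType) (F : 'I_s -> nat -> K) :
  \prod_i \sum_(k < b i ^ g i) F i k = \sum_(k \in Delta b g) \prod_i F i (k i).
Proof.
pose B := (\max_i b i ^ g i)%N.
have MB i : (b i ^ g i <= B)%N.
  exact: (leq_bigmax_cond (F := fun i => b i ^ g i)%N).
under eq_bigr do rewrite (big_ord_widen _ _ (MB _)).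
rewrite (bigA_distr_big_dep (fun i (k : 'I_B) => k < b i ^ g i)%N).
pose val_ffun (f : {ffun 'I_s -> 'I_B}) : {ffun 'I_s -> nat} :=
  [ffun i => nat_of_ord (f i)].
pose fam := family (fun i => [pred k : 'I_B | (k < b i ^ g i)%N]).
have -> : Delta b g = [set` [seq val_ffun f | f <- enum fam]].
  apply/seteqP; split => k /=.
    move=> kD; apply/mapP; exists [ffun i => Ordinal (leq_trans (kD i) (MB i))].
      by rewrite mem_enum; apply/familyP => i; rewrite ffunE inE kD.
    by apply/ffunP => i; rewrite !ffunE.
  move=> /mapP[f]; rewrite mem_enum => /familyP fQ -> i.
  by have := fQ i; rewrite ffunE inE.
rewrite -fsbig_seq; last first.
  rewrite map_inj_uniq ?enum_uniq// => f f' /ffunP ff'; apply/ffunP => i.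
  by apply: val_inj; have := ff' i; rewrite !ffunE.
rewrite big_map big_enum/=; apply: eq_bigr => f _.
by apply: eq_bigr => i _; rewrite ffunE.
Qed.

Lemma Delta0 : (forall i, (0 < b i)%N) -> Delta b g [ffun=> 0%N].
Proof. by move=> b0 i; rewrite ffunE expn_gt0 b0. Qed.

Lemma Delta_star_finite : finite_set (Delta_star b g).
Proof. by apply: sub_finite_set (Delta_finite b g) => k []. Qed.

End products.

(** Turns the gaps [e i] between outer and inner sides into a volume gap of the form of
    [epsilon]. *)
Lemma prod_sub_le (R : realDomainType) (I : Type) (r : seq I) (x y e : I -> R) :
  (forall i, [/\ 0 <= x i, x i <= y i, y i <= 1, y i - x i <= e i & e i <= 1]) ->
  \prod_(i <- r) y i - \prod_(i <- r) x i <= 1 - \prod_(i <- r) (1 - e i).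
Proof.
move=> H.
(* The range and order of the partial products are carried through the induction, whose step
   multiplies nonnegative factors. *)
suff [] : [/\ 0 <= \prod_(i <- r) x i, \prod_(i <- r) x i <= \prod_(i <- r) y i,
  \prod_(i <- r) y i <= 1, 0 <= \prod_(i <- r) (1 - e i) &
  \prod_(i <- r) y i - \prod_(i <- r) x i <= 1 - \prod_(i <- r) (1 - e i)] by [].
elim: r => [|i r [X0 XY Y1 E0 IH]]; first by rewrite !big_nil; split; lra.
rewrite !big_cons; move: X0 XY Y1 E0 IH.
move: (\prod_(i <- r) x i) (\prod_(i <- r) y i) (\prod_(i <- r) (1 - e i)) => X Y E.
move=> X0 XY Y1 E0 IH; have [x0 xy y1 yx e1] := H i.
(* With [d = y i - x i] and [D = Y - X], the quantity [1 - (1 - d) * (1 - D)] exceeds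
   [y i * Y - x i * X] by exactly the two products of [h2] and [h3]. *)
have h1 : (1 - e i) * E <= (1 - (y i - x i)) * (1 - (Y - X)).
  by apply: ler_pM; lra.
have h2 : (1 - y i) * (Y - X) >= 0 by apply: mulr_ge0; lra.
have h3 : (y i - x i) * (1 - Y) >= 0 by apply: mulr_ge0; lra.
split; [exact: mulr_ge0|apply: ler_pM|apply: mulr_ile1| apply: mulr_ge0|]; lra.
Qed.

Lemma indic_le (R : numDomainType) (T : Type) (A B : set T) (x : T) :
  A `<=` B -> \1_A x <= \1_B x :> R.
Proof.
move=> AB; rewrite !indicE ler_nat; have [|//] := boolP (x \in A).
by rewrite inE => /AB Bx; rewrite mem_set.
Qed.

(** * Averages over the points *)

Section averages.
Variables (R : realType) (T : Type) (N : nat) (omega : nat -> T).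

Lemma S_avg_complex (f : T -> R) :
  (S_avg N f omega)%:C%C = S_avg N (fun x => (f x)%:C%C) omega.
Proof. by rewrite /S_avg rmorphM fmorphV rmorph_nat rmorph_sum. Qed.

Lemma S_avg_le (f f' : T -> R) c : (0 < N)%N ->
  (forall n, (n < N)%N -> f (omega n) <= f' (omega n) + c) ->
  S_avg N f omega <= S_avg N f' omega + c.
Proof.
move=> N0 le; rewrite /S_avg ler_pdivrMl ?ltr0n// mulrDr mulVKf; last first.
  by rewrite pnatr_eq0 -lt0n.
apply: (@le_trans _ _ (\sum_(n < N) (f' (omega n) + c))).
  by apply: ler_sum => n _; apply: le.
by rewrite big_split/= sumr_const card_ord mulr_natl.
Qed.

End averages.

(** * Discrepancy of boxes through the hybrid system *)

Section hybrid.
Variables (R : realType) (s1 s2 : nat) (b g : 'I_(s1 + s2) -> nat).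
Hypothesis b2 : forall i, (2 <= b i)%N.
Variables (N : nat) (omega : nat -> (s1 + s2).-tuple R).
Hypothesis N0 : (0 < N)%N.
Hypothesis omega01 :
  forall n, (n < N)%N -> forall i, 0 <= tnth (omega n) i < 1.

Let M i := (b i ^ g i)%N.

Let M0 i : 0 < (M i)%:R :> R. Proof. by rewrite ltr0n expn_gt0 ltnW. Qed.

Definition hybrid_shift (i : 'I_(s1 + s2)) : nat -> (nat -> nat) -> R :=
  if (i < s1)%N then @walsh_shift R else badic_shift R (b i).

Lemma hybrid_shift_causal i j d d' : (forall i, (i < j)%N -> d i = d' i) ->
  hybrid_shift i j d = hybrid_shift i j d'.
Proof.
by rewrite /hybrid_shift; case: ifP => // _; exact: badic_shift_causal.
Qed.

Lemma xiE k x : Delta b g k -> xi b k x =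
  \prod_i chi (b i) (hybrid_shift i) (g i) (k i) (real_digit (b i) (tnth x i)).
Proof.
move=> kD; rewrite big_split_ord/=; congr (_ * _); apply: eq_bigr => i _.
  by rewrite (walshE (b2 _) _ (kD _)) /hybrid_shift/= ltn_ord.
by rewrite (badicE (b2 _) _ (kD _)) /hybrid_shift/= ltnNge leq_addr.
Qed.

(** Each factor sees only the cell of its coordinate, so [coef_expansion] applies to it;
    [prod_sum_Delta] then multiplies out. *)
Lemma prod_expansion (f : 'I_(s1 + s2) -> nat -> R[i]) x :
  (forall i, 0 <= tnth x i < 1) ->
  \prod_i f i (Num.truncn (tnth x i * (M i)%:R)) =
  \sum_(k \in Delta b g)
    (\prod_i coef (b i) (hybrid_shift i) (g i) (f i) (k i)) * xi b k x.
Proof.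
move=> x01; pose F i k := coef (b i) (hybrid_shift i) (g i) (f i) k *
  chi (b i) (hybrid_shift i) (g i) k (real_digit (b i) (tnth x i)).
transitivity (\sum_(k \in Delta b g) \prod_i F i (k i)); last first.
  by apply: eq_fsbigr => k /set_mem kD; rewrite xiE// -big_split.
rewrite -prod_sum_Delta; apply: eq_bigr => i _; rewrite /F.
have /andP[x0 x1] := x01 i.
rewrite (coef_expansion (b2 i) (@hybrid_shift_causal i) (g := g i)); last first.
  by rewrite truncn_lt_nat ?mulr_ge0// gtr_pMl.
apply: eq_bigr => k _; congr (_ * _); apply: eq_chi.
  exact: hybrid_shift_causal.
by move=> j jg; rewrite (real_digit_cell (b2 i) (x01 i) jg).
Qed.

Definition grid_box (l m : 'I_(s1 + s2) -> nat) : set ((s1 + s2).-tuple R) :=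
  box (fun i => (l i)%:R / (M i)%:R) (fun i => (m i)%:R / (M i)%:R).

Definition grid_vol (l m : 'I_(s1 + s2) -> nat) : R :=
  \prod_i ((m i)%:R / (M i)%:R - (l i)%:R / (M i)%:R).

(** Comparing [x] with a grid point at a half-open end amounts to comparing the floor of [x * M]
    with an integer. *)
Lemma indic_grid_box l m x : (forall i, 0 <= tnth x i < 1) ->
  (\1_(grid_box l m) x)%:C%C =
  \prod_i cell_itv R (l i) (m i) (Num.truncn (tnth x i * (M i)%:R)) :> R[i].
Proof.
move=> x01; have E i : (l i)%:R / (M i)%:R <= tnth x i < (m i)%:R / (M i)%:R =
    (l i <= Num.truncn (tnth x i * (M i)%:R) < m i)%N.
  have /andP[x0 _] := x01 i.
  by rewrite truncn_ge_nat ?truncn_lt_nat ?mulr_ge0// ler_pdivrMr// ltr_pdivlMr.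
rewrite indicE; have [|] := boolP (x \in grid_box l m).
  rewrite inE => xJ; rewrite big1// => i _.
  by rewrite /cell_itv -E xJ.
rewrite notin_setE => /existsNP[i xi]; rewrite (bigD1 i)//= /cell_itv -E.
by move/negP/negPf : xi => ->; rewrite mul0r.
Qed.

(** Frequency 0 of the expansion is [grid_vol], so centring removes it and the triangle inequality
    concludes. The weight [w] is abstract to serve both [rho1] and [rho1_star]. *)
Lemma grid_box_discrepancy (w : nat -> nat -> R) (l m : 'I_(s1 + s2) -> nat) :
  (forall i, (l i <= m i <= M i)%N) ->
  (forall i k, (k < M i)%N ->
     normc (coef (b i) (hybrid_shift i) (g i) (cell_itv R (l i) (m i)) k)
       <= w (b i) k) ->
  `|S_avg N (fun x => \1_(grid_box l m) x - grid_vol l m) omega| <=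
  \sum_(k \in Delta_star b g)
    (\prod_i w (b i) (k i)) * normc (S_avg N (xi b k) omega).
Proof.
move=> lm hw; pose C k :=
  \prod_i coef (b i) (hybrid_shift i) (g i) (cell_itv R (l i) (m i)) (k i).
have C0 : C [ffun=> 0%N] = (grid_vol l m)%:C%C.
  rewrite /C /grid_vol rmorph_prod; apply: eq_bigr => i _; rewrite ffunE.
  have /andP[lmi mMi] := lm i.
  rewrite coef_cell_itv0// -mulrBl rmorphM fmorphV rmorph_nat natrB//.
  by rewrite rmorphB !rmorph_nat.
rewrite -normc_real S_avg_complex fsbig_finite; last exact: Delta_star_finite.
have -> : S_avg N (fun x => (\1_(grid_box l m) x - grid_vol l m)%:C%C) omega =
    \sum_(k <- fset_set (Delta_star b g)) C k * S_avg N (xi b k) omega.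
  rewrite /S_avg; under [RHS]eq_bigr do rewrite mulrCA mulr_sumr.
  rewrite -mulr_sumr exchange_big/=; congr (_ * _); apply: eq_bigr => n _.
  have x01 := omega01 (ltn_ord n).
  rewrite rmorphB/= indic_grid_box//.
  rewrite (prod_expansion (fun i => cell_itv R (l i) (m i)) x01).
  rewrite (fsbigD1 [ffun=> 0%N])/=; last 2 first.
  - exact: sub_finite_set (Delta_finite b g).
  - by apply: Delta0 => i; exact: ltnW.
  rewrite -/(C _) C0 xiE; last by apply: Delta0 => i; exact: ltnW.
  rewrite [X in _ * X]big1 ?mulr1; last by move=> i _; rewrite ffunE chi0.
  by rewrite addrAC subrr add0r fsbig_finite//; exact: Delta_star_finite.
apply: le_trans (ler_normc_sum _ _ _) _.
rewrite big_seq [leRHS]big_seq; apply: ler_sum => k.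
rewrite in_fset_set; last exact: Delta_star_finite.
rewrite inE => -[kD _]; rewrite ComplexField.Normc.normcM ler_wpM2r ?sqrtr_ge0//.
  by case: (S_avg _ _ _) => ? ?; exact: sqrtr_ge0.
rewrite normc_prod; apply: ler_prod => i _; rewrite hw ?kD// andbT.
by case: (coef _ _ _ _ _) => ? ?; exact: sqrtr_ge0.
Qed.

(** One coordinate of the enclosure, with [c] the allowed excess of outer over inner cells. The
    inner inclusion is pointwise so that an empty inner interval may lie outside [[u, v)]. *)
Record sandwich (c : nat) (u v : R) (K l0 m0 l1 m1 : nat) : Prop := Sandwich {
  outer_grid : (l0 <= m0 <= K)%N;
  inner_grid : (l1 <= m1 <= K)%N;
  outer_lb : l0%:R / K%:R <= u;
  outer_ub : v <= m0%:R / K%:R;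
  inner_sub : forall y, l1%:R / K%:R <= y < m1%:R / K%:R -> u <= y < v;
  inner_vol : m1%:R / K%:R - l1%:R / K%:R <= v - u;
  sandwich_gap : (m0 - l0 <= m1 - l1 + c)%N }.

(** Monotonicity of indicators compares the box with both grid boxes. Its volume lies between
    theirs, so either volume error is at most the full gap. *)
Lemma box_discrepancy (w : nat -> nat -> R) (c : nat)
    (u v : 'I_(s1 + s2) -> R) (l0 m0 l1 m1 : 'I_(s1 + s2) -> nat) :
  (forall i, (c <= M i)%N) -> (forall i, u i <= v i) ->
  (forall i, sandwich c (u i) (v i) (M i) (l0 i) (m0 i) (l1 i) (m1 i)) ->
  (forall i k, (k < M i)%N ->
     normc (coef (b i) (hybrid_shift i) (g i) (cell_itv R (l0 i) (m0 i)) k)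
       <= w (b i) k) ->
  (forall i k, (k < M i)%N ->
     normc (coef (b i) (hybrid_shift i) (g i) (cell_itv R (l1 i) (m1 i)) k)
       <= w (b i) k) ->
  `|S_avg N (fun x => \1_(box u v) x - fine (lebesgue_tuple (box u v))) omega|
  <= 1 - \prod_i (1 - c%:R * (b i)%:R ^- g i) +
     \sum_(k \in Delta_star b g)
       (\prod_i w (b i) (k i)) * normc (S_avg N (xi b k) omega).
Proof.
move=> cM uv sw w0 w1; rewrite lebesgue_tuple_box//=.
set V := \prod_i (v i - u i); set E := 1 - _; set Sig := \sum_(k \in _) _.
have := grid_box_discrepancy (fun i => outer_grid (sw i)) w0.
have := grid_box_discrepancy (fun i => inner_grid (sw i)) w1.
rewrite -/Sig !ler_norml => /andP[in_lb _] /andP[_ out_ub].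
have grid_ge0 l m i : (l <= m)%N -> 0 <= m%:R / (M i)%:R - l%:R / (M i)%:R :> R.
  by move=> lm; rewrite subr_ge0 ler_pM2r ?invr_gt0// ler_nat.
have in_le : grid_vol l1 m1 <= V.
  apply: ler_prod => i _; rewrite (inner_vol (sw i)) andbT.
  by apply: grid_ge0; have /andP[] := inner_grid (sw i).
have out_le i : v i - u i <= (m0 i)%:R / (M i)%:R - (l0 i)%:R / (M i)%:R.
  by rewrite lerB ?(outer_lb (sw i)) ?(outer_ub (sw i)).
have le_out : V <= grid_vol l0 m0.
  by apply: ler_prod => i _; rewrite subr_ge0 uv/=.
(* The bound [c <= M i] keeps [c / M i] at most 1, as [prod_sub_le] demands. *)
have gap : grid_vol l0 m0 - grid_vol l1 m1 <= E.
  apply: prod_sub_le => i; rewrite -natrX -/(M i).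
  have /andP[lm0 mM0] := outer_grid (sw i).
  have /andP[lm1 mM1] := inner_grid (sw i).
  split.
  - exact: grid_ge0.
  - by apply: le_trans (inner_vol (sw i)) _.
  - rewrite -mulrBl -natrB// ler_pdivrMr// mul1r ler_nat.
    by apply: leq_trans mM0; rewrite leq_subr.
  - rewrite lerBlDl -!mulrBl -!natrB// -mulrDl -natrD ler_pM2r ?invr_gt0//.
    rewrite ler_nat.
    exact: sandwich_gap (sw i).
  - by rewrite ler_pdivrMr// mul1r ler_nat.
have up : S_avg N (fun x => \1_(box u v) x - V) omega <=
    S_avg N (fun x => \1_(grid_box l0 m0) x - grid_vol l0 m0) omega +
    (grid_vol l0 m0 - V).
  apply: S_avg_le => // n _; rewrite addrA subrK lerD2r.
  apply: indic_le => x xJ i; have /andP[ux xv] := xJ i.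
  by rewrite (le_trans (outer_lb (sw i)) ux) (lt_le_trans xv (outer_ub (sw i))).
have lo : S_avg N (fun x => \1_(grid_box l1 m1) x - grid_vol l1 m1) omega <=
    S_avg N (fun x => \1_(box u v) x - V) omega + (V - grid_vol l1 m1).
  apply: S_avg_le => // n _; rewrite addrA subrK lerD2r.
  by apply: indic_le => x xJ i; apply: (inner_sub (sw i)); exact: xJ.
by apply/andP; split; lra.
Qed.

End hybrid.

(** * Enclosing an interval between grid intervals *)

Section grid_approximation.
Variables (R : realType) (K : nat).
Hypothesis K0 : (0 < K)%N.

Let K0' : 0 < K%:R :> R. Proof. by rewrite ltr0n. Qed.

(** Cells open on the left are used so that [v = 1] still gives [m < K]. *)
Lemma last_grid_point (v : R) : 0 < v <= 1 ->
  exists2 m, (m < K)%N & m%:R / K%:R < v <= m.+1%:R / K%:R.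
Proof.
move=> /andP[v0 v1]; have vK0 : 0 < v * K%:R by rewrite mulr_gt0.
suff [m /andP[mv vm]] : exists m, m%:R < v * K%:R <= m.+1%:R.
  exists m; last by rewrite ltr_pdivrMr// ler_pdivlMr// mv.
  by rewrite -(ltr_nat R) (lt_le_trans mv)// ger_pMl.
have /andP[h1 h2] := truncn_itv (ltW vK0).
(* When [v * K] is an integer the floor is one too large; its predecessor exists because [v > 0]. *)
move: h1; rewrite le_eqVlt => /predU1P[e|lt]; last first.
  by exists (Num.truncn (v * K%:R)); rewrite lt ltW.
case E : (Num.truncn (v * K%:R)) e => [|n] e; first by rewrite -e ltxx in vK0.
by exists n; rewrite -e ltr_nat ltnSn lexx.
Qed.

(** The endpoint 0 is a grid point, so only the upper end costs a cell: [c = 1]. *)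
Lemma anchored_sandwich (v : R) : 0 < v <= 1 ->
  exists m, sandwich 1 0 v K 0 m.+1 0 m.
Proof.
move=> v01; have [m mK /andP[mv vm]] := last_grid_point v01.
exists m; split; rewrite ?mul0r ?subr0 ?subn0 ?addn1 ?(ltW mv) ?(ltnW mK)//.
by move=> y /andP[y0 ym]; rewrite y0 (lt_trans ym).
Qed.

(** Rounding costs at most one cell at each end: [c = 2]. *)
Lemma interval_sandwich (u v : R) : 0 <= u -> u < v -> v <= 1 ->
  exists p : (nat * nat) * (nat * nat),
    sandwich 2 u v K p.1.1 p.1.2 p.2.1 p.2.2.
Proof.
move=> u0 uv v1; have v0 : 0 < v by exact: le_lt_trans uv.
have [m mK /andP[mv vm]] := last_grid_point (introT andP (conj v0 v1)).
have uK0 : 0 <= u * K%:R by rewrite mulr_ge0.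
pose l := Num.truncn (u * K%:R).
have lu : l%:R / K%:R <= u by rewrite ler_pdivrMr//; have /andP[] := truncn_itv uK0.
have ul : u <= l.+1%:R / K%:R.
  by rewrite ler_pdivlMr// ltW//; have /andP[] := truncn_itv uK0.
have lm : (l <= m)%N.
  rewrite -ltnS truncn_lt_nat// -ltr_pdivlMr//.
  exact: lt_le_trans vm.
(* If [l = m], rounding inwards would reverse the endpoints, so the empty interval at [m] is the
   inner one. *)
have [lm'|ml] := ltnP l m; [exists ((l, m.+1), (l.+1, m))|exists ((l, m.+1), (m, m))].
  split=> //=; rewrite ?mK ?(ltnW mK) ?(leqW lm)//.
  - by rewrite andbT.
  - by move=> y /andP[ly ym]; rewrite (le_trans ul ly) (lt_trans ym mv).
  - by rewrite lerB// ltW.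
  - by lia.
split=> //=; rewrite ?mK ?leqnn ?(ltnW mK) ?(leqW lm)//.
- by move=> y /andP[my ym]; have := le_lt_trans my ym; rewrite ltxx.
- by rewrite subrr subr_ge0 ltW.
- by lia.
Qed.

End grid_approximation.

Theorem theorem3p12 (R : realType) (s1 s2 : nat) (hs : (0 < s1 + s2)%N)
    (b : 'I_(s1 + s2) -> nat) (hb : forall i, (2 <= b i)%N)
    (N : nat) (hN : (0 < N)%N)
    (omega : nat -> (s1 + s2).-tuple R)
    (homega : forall n, (n < N)%N -> forall i, 0 <= tnth (omega n) i < 1)
    (g : 'I_(s1 + s2) -> nat) (hg : forall i, (0 < g i)%N) :
  discrepancy N omega <=
    epsilon R b g +
    \sum_(k \in Delta_star b g)
      rho R b k * ComplexField.Normc.normc (S_avg N (xi b k) omega)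
  /\
  star_discrepancy N omega <=
    epsilon_star R b g +
    \sum_(k \in Delta_star b g)
      rho_star R b k * ComplexField.Normc.normc (S_avg N (xi b k) omega).
Proof.
have M0 i : (0 < b i ^ g i)%N by rewrite expn_gt0 (ltnW (hb i)).
(* Positivity of [g i] enters here: the constant [c = 2] must not exceed [b i ^ g i]. *)
have M2 i : (2 <= b i ^ g i)%N.
  by rewrite (leq_trans (hb i))// -{1}[b i]expn1 leq_exp2l.
(* Bounding a supremum by [ge_sup] needs a nonempty family; the unit cube belongs to both. *)
split; (apply: ge_sup; first by
  eexists; eexists; [|reflexivity]; (exists (fun=> 0), (fun=> 1)) || exists (fun=> 1);
  split => // i; rewrite ?ltr01 ?lexx).
- move=> _ [_ [u [v [uv ->]]] <-].
  have /choice[p sw] : forall i, exists p : (nat * nat) * (nat * nat),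
      sandwich 2 (u i) (v i) (b i ^ g i) p.1.1 p.1.2 p.2.1 p.2.2.
    by move=> i; have [u0 ui v1] := uv i; exact: interval_sandwich.
  apply: (box_discrepancy (c := 2) (w := rho1 R) hb hN homega _ _ sw) => //.
  + by move=> i; have [_ /ltW] := uv i.
  + move=> i k kM; have /andP[lm mM] := outer_grid (sw i).
    exact: (normc_coef_cell_itv (hb i) (@hybrid_shift_causal R _ _ b i)).
  + move=> i k kM; have /andP[lm mM] := inner_grid (sw i).
    exact: (normc_coef_cell_itv (hb i) (@hybrid_shift_causal R _ _ b i)).
- move=> _ [_ [v [v01 ->]] <-].
  have /choice[m sw] i := anchored_sandwich (M0 i) (v01 i).
  (* The factor 1 is inserted to match [c%:R] at [c = 1]. *)
  rewrite /epsilon_star; under eq_bigr do rewrite -[X in _ - X]mul1r.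
  apply: (box_discrepancy (c := 1) (w := rho1_star R) hb hN homega _ _ sw) => //.
  + by move=> i; have /andP[/ltW] := v01 i.
  + move=> i k kM; have /andP[lm mM] := outer_grid (sw i).
    exact: (normc_coef_cell_itv0 (hb i) (@hybrid_shift_causal R _ _ b i)).
  + move=> i k kM; have /andP[lm mM] := inner_grid (sw i).
    exact: (normc_coef_cell_itv0 (hb i) (@hybrid_shift_causal R _ _ b i)).
Qed.
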